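(* Let $(A,\triangleright_A,\triangleleft_A)$ be a special apre-perm algebra. Then $(A,\triangleright_A)$ is a pre-Lie algebra, while $(A,\diamond_A)$ with $\diamond_A=\triangleright_A+2\triangleleft_A$ is an anti-pre-Lie algebra. In particular, if $(A,\triangleright_A,\triangleleft_A,\mathcal B)$ is a quadratic special apre-perm algebra, then $(A,\diamond_A)$ is exactly the anti-pre-Lie algebra induced from the nondegenerate commutative $2$-cocycle $\mathcal B$ of the sub-adjacent Lie algebra $(A,[-,-]_A)$ of the associated perm algebra $(A,\circ_A)$.
   Context: All vector spaces and algebras are finite-dimensional over an algebraically closed field $\mathbb K$ of characteristic zero. A perm algebra $(A,\circ_A)$ is a vector space with a bilinear operation satisfying $x\circ_A(y\circ_A z)=(x\circ_A y)\circ_A z=(y\circ_A x)\circ_A z$. Its sub-adjacent Lie algebra has bracket $[x,y]_A=x\circ_A y-y\circ_A x$. An apre-perm algebra is a vector space $A$ with multiplications $\triangleright_A,\triangleleft_A:A\otimes A\to A$ such that, setting $x\circ_A y=x\triangleright_A y+x\triangleleft_A y$ and $x\bullet_A y=x\triangleright_A y+y\triangleleft_A x$, $(A,\circ_A)$ is a perm algebra (the associated perm algebra) and for all $x,y,z\in A$: $(x\circ_A y)\bullet_A z=x\bullet_A(y\bullet_A z)=y\bullet_A(x\bullet_A z)$ and $z\triangleleft_A(x\circ_A y)=-(z\triangleleft_A y)\triangleleft_A x=x\bullet_A(z\triangleleft_A y)=(x\bullet_A z)\triangleleft_A y$. It is special if $\triangleleft_A$ is commutative. A quadratic special apre-perm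 algebra $(A,\triangleright_A,\triangleleft_A,\mathcal B)$ is a special apre-perm algebra with a nondegenerate symmetric bilinear form such that $\mathcal B(x\triangleleft_A y,z)=-\mathcal B(x,z\circ_A y)$ for all $x,y,z$. A pre-Lie algebra $(A,\star_A)$ satisfies $(x\star_A y)\star_A z-x\star_A(y\star_A z)=(y\star_A x)\star_A z-y\star_A(x\star_A z)$. An anti-pre-Lie algebra $(A,\diamond_A)$ is a vector space with a bilinear operation such that $[x,y]_A=x\diamond_A y-y\diamond_A x$ defines a Lie algebra and $x\diamond_A(y\diamond_A z)-y\diamond_A(x\diamond_A z)=[y,x]_A\diamond_A z$ for all $x,y,z$. A commutative $2$-cocycle on a Lie algebra $(\mathfrak g,[-,-])$ is a symmetric bilinear form $\mathcal B$ with $\mathcal B([x,y],z)+\mathcal B([y,z],x)+\mathcal B([z,x],y)=0$. A nondegenerate commutative $2$-cocycle $\mathcal B$ on a Lie algebra $(A,[-,-]_A)$ induces an anti-pre-Lie algebra $(A,\diamond_A)$ by $\mathcal B(x\diamond_A y,z)=\mathcal B(y,[x,z]_A)$ (known fact), which satisfies $[x,y]_A=x\diamond_A y-y\diamond_A x$. *)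

(* Defs.v *)
From HB Require Import structures.
From mathcomp Require Import all_boot all_order all_algebra.

Set Implicit Arguments.
Unset Strict Implicit.
Unset Printing Implicit Defensive.

Import GRing.Theory.
Local Open Scope ring_scope.

(* An "algebra" is a finite-dimensional space [A : vectType K] together with   *)
(* products of type {bilinear A -> A -> A}, on which no axiom is imposed       *)
(* beforehand; each kind of algebra is a predicate on such products. The       *)
(* derived products carry bilinear instances, so that bilinearity is part of   *)
(* every statement "(A, m) is a ... algebra" below.                            *)

Section DerivedProducts.
Variables (K : fieldType) (A : vectType K).
Implicit Types m tr tl : {bilinear A -> A -> A}.

Definition sub_bracket m (x y : A) : A := m x y - m y x.

Definition apre_circ tr tl (x y : A) : A := tr x y + tl x y.

(* The second summand is [tl y x], not [tl x y].                               *)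
Definition apre_bullet tr tl (x y : A) : A := tr x y + tl y x.

Definition apre_diamond tr tl (x y : A) : A := tr x y + 2%:R *: tl x y.

Fact sub_bracket_bilinear m : bilinear_for *:%R *:%R (sub_bracket m).
Proof.
split=> [y a x x' | x a y y']; rewrite /sub_bracket !linearPl !linearPr /=;
  by rewrite opprD addrACA scalerBr.
Qed.
HB.instance Definition _ m :=
  bilinear_isBilinear.Build K A A A *:%R *:%R (sub_bracket m)
    (sub_bracket_bilinear m).

Fact apre_circ_bilinear tr tl : bilinear_for *:%R *:%R (apre_circ tr tl).
Proof.
split=> [y a x x' | x a y y']; rewrite /apre_circ ?linearPl ?linearPr /=;
  by rewrite addrACA scalerDr.
Qed.
HB.instance Definition _ tr tl :=
  bilinear_isBilinear.Build K A A A *:%R *:%R (apre_circ tr tl)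
    (apre_circ_bilinear tr tl).

Fact apre_bullet_bilinear tr tl : bilinear_for *:%R *:%R (apre_bullet tr tl).
Proof.
split=> [y a x x' | x a y y']; rewrite /apre_bullet !linearPl !linearPr /=;
  by rewrite addrACA scalerDr.
Qed.
HB.instance Definition _ tr tl :=
  bilinear_isBilinear.Build K A A A *:%R *:%R (apre_bullet tr tl)
    (apre_bullet_bilinear tr tl).

Fact apre_diamond_bilinear tr tl : bilinear_for *:%R *:%R (apre_diamond tr tl).
Proof.
split=> [y a x x' | x a y y']; rewrite /apre_diamond ?linearPl ?linearPr /=;
  by rewrite scalerDr addrACA scalerDr !scalerA [a * _]mulrC.
Qed.
HB.instance Definition _ tr tl :=
  bilinear_isBilinear.Build K A A A *:%R *:%R (apre_diamond tr tl)
    (apre_diamond_bilinear tr tl).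

End DerivedProducts.

Section Algebras.
Variables (K : fieldType) (A : vectType K).
Implicit Types (m br tr tl : {bilinear A -> A -> A}) (B : {symmetric A}).

Definition is_Lie br : Prop :=
  (forall x, br x x = 0)
  /\ (forall x y z, br x (br y z) + br y (br z x) + br z (br x y) = 0).

Definition is_perm m : Prop :=
  forall x y z, m x (m y z) = m (m x y) z /\ m (m x y) z = m (m y x) z.

Definition is_pre_Lie m : Prop :=
  forall x y z,
    m (m x y) z - m x (m y z) = m (m y x) z - m y (m x z).

Definition is_anti_pre_Lie m : Prop :=
  is_Lie (sub_bracket m)
  /\ (forall x y z, m x (m y z) - m y (m x z) = m (sub_bracket m y x) z).

Definition is_apre_perm tr tl : Prop :=
  let circ := apre_circ tr tl in
  let bullet := apre_bullet tr tl in
  [/\ is_perm (apre_circ tr tl),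
      forall x y z, bullet (circ x y) z = bullet x (bullet y z)
                 /\ bullet x (bullet y z) = bullet y (bullet x z)
    & forall x y z, [/\ tl z (circ x y) = - tl (tl z y) x,
                        - tl (tl z y) x = bullet x (tl z y)
                      & bullet x (tl z y) = tl (bullet x z) y]].

Definition is_special_apre_perm tr tl : Prop :=
  is_apre_perm tr tl /\ (forall x y, tl x y = tl y x).

Definition is_quadratic_special_apre_perm tr tl B : Prop :=
  [/\ is_special_apre_perm tr tl, nondegenerate B
    & forall x y z, B (tl x y) z = - B x (apre_circ tr tl z y)].

Definition is_commutative_2cocycle br B : Prop :=
  forall x y z, B (br x y) z + B (br y z) x + B (br z x) y = 0.

(* When [B] is nondegenerate there is at most one such [m].                    *)
Definition is_induced_product br B m : Prop :=
  forall x y z, B (m x y) z = B y (br x z).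

End Algebras.

(* Main.v *)
Require Import Defs.
From mathcomp Require Import all_boot all_order all_algebra.

Import GRing.Theory.
Local Open Scope ring_scope.

(** Write c for the product of the associated perm algebra and l for the
    commutative product [tl].  As l is commutative, the product written as a
    bullet in the axioms is c itself, and the axioms become three rules that
    turn l z (c x y), c x (l z y) and l (c x z) y into opposites of iterated
    products of l.  Since [tr] is c - l and [apre_diamond] is c + l, expanding
    with these rules gives, for r = c - l and d = c + l,
      r (r x y) z - r x (r y z)
        = l (l x y) z - c (l x y) z - (l (l y z) x + l (l x z) y),
      d x (d y z) = c x (c y z) - l (l x z) y.
    The right-hand side of the first formula is visibly symmetric in x and y,
    which is the pre-Lie identity.  In the second, c x (c y z) is symmetric in
    x and y, so the commutator of the left multiplications by x and y is a
    difference of two iterated products of l; the rules also identify this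
    difference with d [y, x] z.  The commutator of d is that of c, hence a Lie
    bracket, because a perm algebra is associative.

    For a quadratic algebra, invariance and the symmetry of the form give
    B (c x y) z = - B (l y z) x.  Both the cocycle identity and
    B (d x y) z = B y [x, z] follow by writing each term as a value of B on a
    product l and using that l is commutative; nondegeneracy makes the induced
    product unique. *)

Lemma symmetric_formC {K : fieldType} {A : vectType K} (B : {symmetric A}) x y :
  B x y = B y x.
Proof. by rewrite hermC expr0 mul1r. Qed.

Lemma nondegenerate_inj {K : fieldType} {A : vectType K} (B : {symmetric A}) :
  nondegenerate B -> forall u v, (forall w, B u w = B v w) -> u = v.
Proof.
move=> /eqP rad0 u v Buv; apply/eqP; rewrite -subr_eq0 -memv0 -rad0.
by apply/mem_orthovP => w _; rewrite linearBl /= Buv subrr.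
Qed.

(** A perm product is associative and left-commutative, so the double bracket
    [x, [y, z]] shortens to x(yz) - x(zy); the Jacobi sum of these then cancels
    in pairs. *)
Lemma perm_sub_bracket_Lie {K : fieldType} {A : vectType K}
    (m : {bilinear A -> A -> A}) :
  is_perm m -> is_Lie (sub_bracket m).
Proof.
move=> permm.
have mA x y z : m (m x y) z = m x (m y z) by case: (permm x y z).
have mCA x y z : m x (m y z) = m y (m x z).
  by rewrite -!mA; case: (permm x y z).
have bracket2 x y z :
    sub_bracket m x (sub_bracket m y z) = m x (m y z) - m x (m z y).
  by rewrite /sub_bracket linearBr linearBl /= !mA (mCA z y x) subrr subr0.
split=> [x | x y z]; first by rewrite /= /sub_bracket subrr.
rewrite /= !bracket2 (mCA y x z) (mCA z y x) (mCA z x y).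
by rewrite [X in X + _]addrC !subrKA subrr.
Qed.

(** The axioms of a special apre-perm algebra expressed through
    c = [apre_circ tr tl] and l = [tl] only, oriented as rewriting rules towards
    iterated products of l. *)
Definition special_apre_perm_rules {K : fieldType} {A : vectType K}
    (c l : {bilinear A -> A -> A}) : Prop :=
  [/\ is_perm c,
      forall x y, l x y = l y x,
      forall x y z, l z (c x y) = - l (l z y) x,
      forall x y z, c x (l z y) = - l (l z y) x
    & forall x y z, l (c x z) y = - l (l z y) x].

(** Commutativity of [tl] turns the bullet product of the axioms into the perm
    product. *)
Lemma special_apre_perm_rulesP {K : fieldType} {A : vectType K}
    (tr tl : {bilinear A -> A -> A}) :
  is_special_apre_perm tr tl -> special_apre_perm_rules (apre_circ tr tl) tl.
Proof.
move=> [[permc _ ax] tlC].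
have bulletE x y : apre_bullet tr tl x y = apre_circ tr tl x y.
  by rewrite /apre_bullet tlC.
split=> // x y z; case: (ax x y z); rewrite /= !bulletE => l_c c_l l_cl.
- exact: l_c.
- exact: esym c_l.
by rewrite -l_cl -c_l.
Qed.

(** Exchanging x and y fixes the first two terms of the right-hand side and
    swaps the last two; this is the pre-Lie identity for c - l. *)
Lemma circ_sub_associator {K : fieldType} {A : vectType K}
    (c l : {bilinear A -> A -> A}) (rules : special_apre_perm_rules c l) x y z :
  let r u v := c u v - l u v in
  r (r x y) z - r x (r y z)
    = l (l x y) z - c (l x y) z - (l (l y z) x + l (l x z) y).
Proof.
have [permc lC l_c c_l l_cl] := rules.
have cA : c (c x y) z = c x (c y z) by case: (permc x y z).
rewrite /= !linearBl !linearBr /= l_cl c_l l_c cA.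
(* The common part c x (c y z) + l (l y z) x is gathered and cancelled. *)
rewrite -!opprD !opprK [l x (l y z)]lC addrACA opprD [LHS]addrACA subrr add0r.
by rewrite [- _ + _]addrC [l (l x z) y + _]addrC.
Qed.

(** The terms c x (l y z) and l x (l y z) cancel; this is what the coefficient
    2 of [tl] in [apre_diamond] achieves. *)
Lemma circ_add_left_mul2 {K : fieldType} {A : vectType K}
    (c l : {bilinear A -> A -> A}) (rules : special_apre_perm_rules c l) x y z :
  let d u v := c u v + l u v in
  d x (d y z) = c x (c y z) - l (l x z) y.
Proof.
have [_ lC l_c c_l _] := rules.
rewrite /= !linearDr /= c_l l_c [l x (l y z)]lC.
by rewrite [- _ + _]addrC subrKA.
Qed.

(** Both sides equal l (l y z) x - l (l x z) y. *)
Lemma circ_add_left_commutator {K : fieldType} {A : vectType K}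
    (c l : {bilinear A -> A -> A}) (rules : special_apre_perm_rules c l) x y z :
  let d u v := c u v + l u v in
  d x (d y z) - d y (d x z) = d (c y x - c x y) z.
Proof.
have [permc lC _ _ l_cl] := rules.
have cCA : c x (c y z) = c y (c x z).
  by case: (permc x y z) => -> ->; case: (permc y x z).
have cC : c (c y x) z = c (c x y) z by case: (permc y x z).
rewrite /= !(circ_add_left_mul2 c l rules) cCA !linearBl /= cC !l_cl.
by rewrite subrr add0r opprB addrC subrKA opprK [RHS]addrC.
Qed.

(** In terms of T x y z = B (l x y) z, symmetric in x and y, the form B [x, y] z
    is T x z y - T y z x, whose cyclic sum telescopes. *)
Lemma invariant_form_cocycle {K : fieldType} {A : vectType K}
    (c l : {bilinear A -> A -> A}) (lC : forall x y, l x y = l y x)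
    (B : {symmetric A}) (invB : forall x y z, B (l x y) z = - B x (c z y)) :
  is_commutative_2cocycle (sub_bracket c) B.
Proof.
have Bc x y z : B (c x y) z = - B (l y z) x.
  by rewrite symmetric_formC [l y z]lC invB opprK.
move=> x y z.
rewrite /= /sub_bracket !linearBl /= !Bc [l z x]lC [l z y]lC [l y x]lC.
by rewrite !opprK !(addrC (- _)) [X in X + _]addrC !subrKA subrr.
Qed.

Lemma invariant_form_induced {K : fieldType} {A : vectType K}
    (c l : {bilinear A -> A -> A}) (lC : forall x y, l x y = l y x)
    (B : {symmetric A}) (invB : forall x y z, B (l x y) z = - B x (c z y))
    x y z :
  B (c x y + l x y) z = B y (sub_bracket c x z).
Proof.
have Bc u v w : B u (c v w) = - B (l u w) v by rewrite invB opprK.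
rewrite linearDl /= linearBr /= [B (c x y) z]symmetric_formC !Bc opprK.
by rewrite [l z y]lC [l y x]lC.
Qed.

Theorem proposition3p37 (K : closedFieldType) (charK : [pchar K] =i pred0)
    (A : vectType K) (tr tl : {bilinear A -> A -> A})
    (special : is_special_apre_perm tr tl) :
  [/\ is_pre_Lie tr,
      is_anti_pre_Lie (apre_diamond tr tl)
    & forall B : {symmetric A},
        is_quadratic_special_apre_perm tr tl B ->
        let br := sub_bracket (apre_circ tr tl) in
        [/\ is_Lie br,
            nondegenerate B,
            is_commutative_2cocycle br B,
            is_induced_product br B (apre_diamond tr tl)
          & forall m : {bilinear A -> A -> A},
              is_induced_product br B m ->
              forall x y, m x y = apre_diamond tr tl x y]].
Proof.
have rules := special_apre_perm_rulesP tr tl special.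
have [permc tlC _ _ _] := rules.
have trE x y : tr x y = apre_circ tr tl x y - tl x y by rewrite addrK.
have diamondE x y : apre_diamond tr tl x y = apre_circ tr tl x y + tl x y.
  by rewrite /apre_diamond scaler_nat mulr2n addrA.
have bracketE x y :
    sub_bracket (apre_diamond tr tl) x y = sub_bracket (apre_circ tr tl) x y.
  by rewrite /sub_bracket /= !diamondE [tl y x]tlC opprD addrACA subrr addr0.
have Lie_br := perm_sub_bracket_Lie _ permc.
split.
- have assocE x y z :
      tr (tr x y) z - tr x (tr y z)
        = tl (tl x y) z - apre_circ tr tl (tl x y) z
          - (tl (tl y z) x + tl (tl x z) y).
    rewrite (trE (tr x y)) (trE x (tr y z)) (trE x y) (trE y z).
    exact: (circ_sub_associator _ _ rules x y z).
  by move=> x y z; rewrite !assocE (tlC y x) [X in _ - X]addrC.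
- split; last first.
    move=> x y z; rewrite /= bracketE !diamondE.
    exact: (circ_add_left_commutator _ _ rules x y z).
  case: Lie_br => brxx Jacobi.
  by split=> [x | x y z]; rewrite /= !bracketE; [apply: brxx | apply: Jacobi].
move=> B [_ nondegB invB] br.
have induced_diamond : is_induced_product br B (apre_diamond tr tl).
  by move=> x y z; rewrite /= diamondE; apply: invariant_form_induced.
split=> //; first exact: invariant_form_cocycle tlC B invB.
move=> m induced_m x y; apply: nondegenerate_inj nondegB _ _ _ => w.
by rewrite induced_m -induced_diamond.
Qed.
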